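(* Let $\mathbb{F}$ be a field with $|\mathbb{F}|\geq 4$. Every matrix in $SL_2(\mathbb{F})$ is a product of at most six $\mathcal{U}_2$-matrices. If $n>2$, then every matrix in $SL_n(\mathbb{F})$ is a product of at most eight $\mathcal{U}_2$-matrices.
   Context: $SL_n(\mathbb{F})$ is the group of $n\times n$ matrices over $\mathbb F$ with determinant $1$. A matrix $X\in M_n(\mathbb{F})$ is a $\mathcal{U}_2$-matrix (unipotent matrix of index $2$) if $(X-I_n)^2=0_n$ and $X\neq I_n$. *)

(* Defs.v *)
From mathcomp Require Import all_boot all_order all_algebra.
Set Implicit Arguments.
Unset Strict Implicit.
Unset Printing Implicit Defensive.
Import GRing.Theory.
Local Open Scope ring_scope.

Definition U2_matrix (F : fieldType) (n : nat) (X : 'M[F]_n) : bool :=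
  ((X - 1%:M) ^+ 2 == 0) && (X != 1%:M).

(* The empty product is 1%:M. Allowing it does not change the notion for
   n >= 2: if X is a U2-matrix, so is its inverse 2%:M - X. *)
Definition prod_at_most_U2 (F : fieldType) (n k : nat) (A : 'M[F]_n) : Prop :=
  exists s : seq 'M[F]_n,
    [/\ (size s <= k)%N, all (@U2_matrix F n) s & A = \prod_(X <- s) X].

(* Main.v *)
(* A nonscalar matrix of determinant 1 is similar to a product L U of lower and
   upper unitriangular matrices: conjugate so that the top left entry is 1 and
   the Schur complement is again nonscalar, then induct.  A unitriangular matrix
   is a product of two unitriangular ones with nowhere zero subdiagonal, and
   each of these, being similar to a single Jordan block, is similar to a
   product of two bidiagonal U_2-matrices (odd and even columns).  In dimension
   2 unitriangular matrices are themselves U_2 or 1, so SL_2 needs at most three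
   factors.  A scalar a I_n with a^n = 1 is a product of two block diagonal
   matrices with blocks diag(b, 1/b) or (1), whence six factors. *)
Require Import Defs.
From mathcomp Require Import all_boot all_order all_algebra.
Set Implicit Arguments.
Unset Strict Implicit.
Unset Printing Implicit Defensive.
Import GRing.Theory.
Local Open Scope ring_scope.

Section SquareZeroProducts.
Variable F : fieldType.

(** * Closure properties of products of matrices [X] with [(X - 1)^2 = 0] *)

(* Unlike U2_matrix, unip2 includes 1, so that a product of exactly k factors
   is also a product of exactly k + 1 factors. *)
Definition unip2 n (X : 'M[F]_n) := (X - 1%:M) *m (X - 1%:M) = 0.

Fixpoint unip2_prod n k (A : 'M[F]_n) : Prop :=
  if k is k'.+1 then
    exists X B, [/\ unip2 X, unip2_prod k' B & A = X *m B]
  else A = 1%:M.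

Lemma unip2_1 n : unip2 (1%:M : 'M[F]_n).
Proof. by rewrite /unip2 subrr mul0mx. Qed.

Lemma unip2_prod1 n k : unip2_prod k (1%:M : 'M[F]_n).
Proof.
elim: k => [|k IHk] //=; exists 1%:M, 1%:M.
by split=> //; [exact: unip2_1 | rewrite mulmx1].
Qed.

Lemma unip2_prod_unip2 n (X : 'M[F]_n) : unip2 X -> unip2_prod 1 X.
Proof. by move=> uX; exists X, 1%:M; rewrite mulmx1. Qed.

Lemma unip2_prodM n k l (A B : 'M[F]_n) :
  unip2_prod k A -> unip2_prod l B -> unip2_prod (k + l) (A *m B).
Proof.
elim: k A => [|k IHk] A /= => [-> | [X [C [uX qC ->]]]] qB.
  by rewrite mul1mx.
by exists X, (C *m B); rewrite mulmxA; split=> //; apply: IHk.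
Qed.

Lemma unip2_prod_conj n k (P A B : 'M[F]_n) :
  P \in unitmx -> P *m A = B *m P -> unip2_prod k B -> unip2_prod k A.
Proof.
move=> uP; elim: k A B => [|k IHk] A B eAB /= => [B1|[X [C [uX qC defB]]]].
  by rewrite -(mulKmx uP A) eAB B1 mul1mx mulVmx.
exists (invmx P *m X *m P), (invmx P *m C *m P); split.
- have -> : invmx P *m X *m P = 1%:M + invmx P *m (X - 1%:M) *m P.
    by rewrite mulmxBr mulmxBl mulmx1 mulVmx // addrC subrK.
  rewrite /unip2 addrC addKr !mulmxA mulmxK //.
  by rewrite -(mulmxA (invmx P)) uX mulmx0 mul0mx.
- by apply: (IHk _ C) qC; rewrite !mulmxA mulmxV // mul1mx.
- by rewrite -(mulKmx uP A) eAB defB !mulmxA mulmxK.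
Qed.

Lemma unip2_prod_tr n k (A : 'M[F]_n) : unip2_prod k A -> unip2_prod k A^T.
Proof.
elim: k A => [|k IHk] A => [->|[X [B [uX qB ->]]]]; first exact: trmx1.
rewrite -addn1 trmx_mul; apply: unip2_prodM (IHk _ qB) _.
apply: unip2_prod_unip2; rewrite /unip2.
by rewrite -trmx1 -linearB /= -trmx_mul uX trmx0.
Qed.

(** If [N = X - 1] squares to zero, then [1 - N] inverts [X] and has the same form; the factors are
    inverted in reverse order. *)
Lemma unip2_prod_inv n k (A : 'M[F]_n) :
  unip2_prod k A -> exists2 B, unip2_prod k B & B *m A = 1%:M.
Proof.
elim: k A => [|k IHk] A => [->|[X [B [uX qB ->]]]].
  by exists 1%:M; rewrite ?mulmx1.
have [C qC CB] := IHk _ qB.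
pose Y := 1%:M - (X - 1%:M).
have uY : unip2 Y by rewrite /unip2 /Y addrC addKr mulmxN mulNmx uX !oppr0.
have YX : Y *m X = 1%:M.
  rewrite -[X in _ *m X](subrK 1%:M) mulmxDr mulmx1 {1}/Y mulmxBl uX mul1mx.
  by rewrite subr0 /Y addrC subrK.
exists (C *m Y).
  by rewrite -addn1; apply: unip2_prodM qC (unip2_prod_unip2 uY).
by rewrite -mulmxA (mulmxA Y) YX mul1mx.
Qed.

Lemma unip2_prod_block m n k (A : 'M[F]_m) (B : 'M[F]_n) :
  unip2_prod k A -> unip2_prod k B -> unip2_prod k (block_mx A 0 0 B).
Proof.
elim: k A B => [|k IHk] A B /= => [->->|]; first by rewrite -scalar_mx_block.
move=> [X [A' [uX qA ->]]] [Y [B' [uY qB ->]]].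
exists (block_mx X 0 0 Y), (block_mx A' 0 0 B'); split; last 1 first.
- by rewrite mulmx_block !mulmx0 !mul0mx !addr0 add0r.
- rewrite /unip2 scalar_mx_block opp_block_mx add_block_mx !subr0.
  by rewrite mulmx_block uX uY !mulmx0 !mul0mx !addr0 block_mx0.
- exact: IHk.
Qed.

(** Factors equal to 1 are dropped, which turns exactly [k] factors into at most [k]. *)
Lemma unip2_prod_at_most_U2 n k (A : 'M[F]_n) :
  unip2_prod k A -> prod_at_most_U2 k A.
Proof.
elim: k A => [|k IHk] A /= => [->|[X [B [uX /IHk[s [sz_s Us ->]] ->]]]].
  by exists [::]; rewrite big_nil.
have [->|X1] := eqVneq X 1%:M; first by exists s; rewrite mul1mx leqW.
exists (X :: s); rewrite /= ltnS Us big_cons; split=> //.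
by rewrite andbT /U2_matrix X1 andbT; apply/eqP.
Qed.

(** * Unitriangular matrices as products of four factors *)

Definition unitrig n (L : 'M[F]_n) :=
  forall i j : 'I_n, (i <= j)%N -> L i j = (i == j)%:R.

(** These are the regular unipotent lower triangular matrices: [L - 1] is nilpotent of maximal
    index. *)
Definition regtrig n (L : 'M[F]_n) :=
  unitrig L /\ forall i j : 'I_n, i = j.+1 :> nat -> L i j != 0.

Lemma unitrig_mulmx n (A B : 'M[F]_n) :
  unitrig A -> unitrig B -> unitrig (A *m B).
Proof.
move=> tA tB i j le_ij; rewrite mxE (bigD1 i) //= tA // eqxx mul1r tB //.
rewrite big1 ?addr0 // => k ki.
have [le_ik|lt_ki] := leqP i k; first by rewrite tA // eq_sym (negPf ki) mul0r.
rewrite tB ?(leq_trans (ltnW lt_ki)) // -val_eqE.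
by rewrite ltn_eqF ?mulr0 // (leq_trans lt_ki).
Qed.

Lemma unitrig_subdiag n (A B : 'M[F]_n) (i j : 'I_n) :
    unitrig A -> unitrig B -> i = j.+1 :> nat ->
  (A *m B) i j = A i j + B i j.
Proof.
move=> tA tB ij; have nij: j != i by rewrite -val_eqE /= ij ltn_eqF.
rewrite mxE (bigD1 i) // (bigD1 j) //= tA // eqxx mul1r (tB j) // eqxx mulr1.
rewrite big1 ?addr0 1?addrC // => k /andP[ki kj].
have [le_ik|lt_ki] := leqP i k; first by rewrite tA // eq_sym (negPf ki) mul0r.
by rewrite (tB k) ?(negPf kj) ?mulr0 // -ltnS -ij.
Qed.

Definition shift n : 'M[F]_n := \matrix_(i, j) (i == j.+1 :> nat)%:R.

(** The first basis vector is cyclic for [N = L - 1]: the columns [c k = N^k e_0] form a triangular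
    matrix with nonzero diagonal, and in this basis [N] acts as the shift. *)
Lemma regtrig_sim_shift n (L : 'M[F]_n.+1) : regtrig L ->
  exists2 P, P \in unitmx & L *m P = P *m (1%:M + shift n.+1).
Proof.
move=> [tL rL]; pose N := L - 1%:M.
have N0 (i j : 'I_n.+1) : (i <= j)%N -> N i j = 0.
  by move=> ?; rewrite !mxE tL // subrr.
have N1 (i j : 'I_n.+1) : i = j.+1 :> nat -> N i j != 0.
  by move=> ij; rewrite !mxE -val_eqE /= [in X in X%:R]ij gtn_eqF // subr0 rL.
pose c k := iter k (mulmx N) (delta_mx ord0 ord0 : 'cV[F]_n.+1).
have c0 k (i : 'I_n.+1) : (i < k)%N -> c k i 0 = 0.
  elim: k i => // k IHk i lt_ik; rewrite /= mxE big1 // => j _.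
  have [/N0->|lt_ji] := leqP i j; first by rewrite mul0r.
  by rewrite IHk ?mulr0 // (leq_trans lt_ji).
have c1 k (i : 'I_n.+1) : i = k :> nat -> c k i 0 != 0.
  elim: k i => [|k IHk] i ik; first by rewrite mxE -!val_eqE /= ik oner_neq0.
  have lt_kn : (k < n.+1)%N by rewrite ltnW // -ik.
  rewrite /= mxE (bigD1 (Ordinal lt_kn)) //= big1 ?addr0.
    by rewrite mulf_neq0 ?N1 ?IHk.
  move=> j; rewrite -val_eqE /= neq_ltn => /orP[lt_jk | lt_kj].
    by rewrite c0 ?mulr0.
  by rewrite N0 ?mul0r // ik.
exists (\matrix_(i, j) c j i 0).
  rewrite unitmxE det_trig; last first.
    by apply/is_trig_mxP=> i j lt_ij; rewrite mxE c0.
  by rewrite unitfE; apply/prodf_neq0=> i _; rewrite mxE c1.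
rewrite -{1}(subrK 1%:M L) -/N addrC mulmxDl mulmxDr mul1mx mulmx1.
congr (_ + _); apply/matrixP=> i j.
have -> : (N *m (\matrix_(i, j) c j i 0)) i j = c j.+1 i 0.
  rewrite /= [LHS]mxE [RHS]mxE; apply: eq_bigr => k _.
  by rewrite [X in _ * X]mxE.
rewrite [RHS]mxE; have [lt_jn|le_nj] := ltnP j.+1 n.+1.
  rewrite (bigD1 (Ordinal lt_jn)) //= big1 ?addr0 => [|k].
    by rewrite [X in X * _]mxE [X in _ * X]mxE eqxx mulr1.
  by rewrite -val_eqE [X in _ * X]mxE /= => /negPf->; rewrite mulr0.
(* In the last column the shift has no successor, which matches [N^(n+1) e_0 = 0]. *)
rewrite c0 ?(leq_trans (ltn_ord i)) // big1 // => k _.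
by rewrite [X in _ * X]mxE ltn_eqF ?mulr0 // (leq_trans (ltn_ord k)).
Qed.

(** The product [M] has every subdiagonal entry 1, each coming from the factor of matching column
    parity. So [M] is regular too, and [L] and [M] are similar to the same Jordan block. *)
Lemma regtrig_unip2_prod n (L : 'M[F]_n.+1) : regtrig L -> unip2_prod 2 L.
Proof.
pose E b : 'M[F]_n.+1 := \matrix_(i, j) ((i == j.+1 :> nat) && (odd j == b))%:R.
have tE b : unitrig (1%:M + E b).
  by move=> i j le_ij; rewrite !mxE ltn_eqF ?addr0.
have uE b : unip2 (1%:M + E b).
  (* A nonzero term would need [k = j + 1] with [k] and [j] both of parity [b]. *)
  rewrite /unip2 addrC addKr; apply/matrixP=> i j; rewrite !mxE big1 // => k _.
  rewrite !mxE; case: eqP => [_|]; rewrite ?mul0r //=.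
  have [->|] := eqVneq (k : nat) j.+1; last by rewrite mulr0.
  by rewrite /=; case: b; case: (odd j); rewrite /= ?(mulr0n, mulr0, mul0r).
pose M := (1%:M + E true) *m (1%:M + E false).
have rM : regtrig M.
  split=> [|i j ij]; first exact: unitrig_mulmx.
  rewrite unitrig_subdiag // !mxE -val_eqE /= ij eqxx gtn_eqF //= !add0r.
  by case: (odd j); rewrite /= ?addr0 ?add0r oner_neq0.
have qM : unip2_prod 2 M.
  by apply: (@unip2_prodM _ 1 1); apply: unip2_prod_unip2.
have [P uP eP] := regtrig_sim_shift rM.
move=> /regtrig_sim_shift[R uR eR].
have qJ : unip2_prod 2 (1%:M + shift n.+1).
  by apply: (unip2_prod_conj uP) qM.
apply: (@unip2_prod_conj _ _ (invmx R) _ _ _ _ qJ); first by rewrite unitmx_inv.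
by rewrite -[L in LHS](mulmxK uR) eR !mulmxA mulVmx // mul1mx.
Qed.

(** Write [L = V^-1 (V L)] with [V] bidiagonal. Subdiagonals add under multiplication, so [v x] must
    avoid both 0 and [-x]: the value 1 does unless [x = -1], where [w] takes over. *)
Lemma unitrig_unip2_prod n (L : 'M[F]_n.+1) (w : F) :
  w != 0 -> w != 1 -> unitrig L -> unip2_prod 4 L.
Proof.
move=> w0 w1 tL; pose v (x : F) : F := if x == -1 then w else 1.
have v0 x : v x != 0 by rewrite /v; case: ifP; rewrite // oner_neq0.
have vD x : v x + x != 0.
  rewrite /v; have [->|x1] := eqVneq x (-1); first by rewrite subr_eq0.
  by rewrite addrC addr_eq0.
pose V : 'M[F]_n.+1 :=
  \matrix_(i, j) ((i == j)%:R + (v (L i j) *+ (i == j.+1 :> nat))).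
have tV : unitrig V by move=> i j le_ij; rewrite mxE ltn_eqF // addr0.
have sV (i j : 'I_n.+1) : i = j.+1 :> nat -> V i j = v (L i j).
  by move=> ij; rewrite mxE ij eqxx -val_eqE /= ij gtn_eqF // add0r.
have [|B qB BV] := @unip2_prod_inv _ 2 V.
  by apply: regtrig_unip2_prod; split=> // i j ij; rewrite sV.
rewrite -(mul1mx L) -BV -mulmxA; apply: (@unip2_prodM _ 2 2) => //.
apply: regtrig_unip2_prod; split=> [|i j ij]; first exact: unitrig_mulmx.
by rewrite unitrig_subdiag // sV.
Qed.

(** * Nonscalar matrices of determinant 1 up to similarity *)

(** If all [e_i] are row eigenvectors, [A] is diagonal; if all [e_i + e_j] are as well, its diagonal
    entries agree. *)
Lemma nonscalar_row n (A : 'M[F]_n) :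
  ~~ is_scalar_mx A -> exists v : 'rV_n, ~~ (v *m A <= v)%MS.
Proof.
move=> nsA.
have [i ev1|ev1] :=
    pickP [pred i | ~~ (('e_i : 'rV_n) *m A <= ('e_i : 'rV_n))%MS].
  by exists 'e_i.
have [[i j] /= ev2|ev2] := pickP [pred ij : 'I_n * 'I_n |
    let v : 'rV_n := 'e_ij.1 + 'e_ij.2 in ~~ (v *m A <= v)%MS].
  by exists ('e_i + 'e_j).
case/negP: nsA; case: n A ev1 ev2 => [|n] A ev1 ev2.
  by apply/is_scalar_mxP; exists 0; rewrite flatmx0 [RHS]flatmx0.
have dA i j : A i j = A i i *+ (i == j).
  have /negbFE/sub_rVP[a] := ev1 i; rewrite -rowE => /rowP ea.
  have:= ea j; have:= ea i; rewrite !mxE !eqxx mulr1 eq_sym /= => -> ->.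
  by rewrite mulr_natr.
apply/is_scalar_mxP; exists (A 0 0); apply/matrixP=> i j.
rewrite [LHS]dA [RHS]mxE; congr (_ *+ _); have [->//|i0] := eqVneq i 0.
have /negbFE/sub_rVP[a] /= := ev2 (i, 0).
rewrite mulmxDl -!rowE => /rowP ea; have:= ea 0; have:= ea i.
rewrite !mxE !eqxx (dA i 0) (dA 0 i) ![0 == i]eq_sym (negPf i0) /=.
by rewrite !mulr0n !addr0 !add0r mulr1 => -> ->.
Qed.

Lemma shear_block m a (r : 'rV[F]_m) c D y :
  block_mx 1%:M 0 (- y) 1%:M *m block_mx (a : 'M_1) r c D =
  block_mx (a + r *m y) r (c + D *m y - y *m (a + r *m y)) (D - y *m r)
    *m block_mx 1%:M 0 (- y) 1%:M.
Proof.
rewrite !mulmx_block !mul1mx !mul0mx !mulmx1 !mulmx0 !addr0 add0r.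
rewrite !(mulmxDr, mulmxN, mulNmx, mulmxBl) !mulmxA.
congr block_mx; [by rewrite addrK | | by rewrite add0r addrC].
by rewrite opprB opprD !addrA subrK addrAC addrK addrC.
Qed.

Lemma shear_unit m (y : 'cV[F]_m) :
  (block_mx 1%:M 0 y 1%:M : 'M_(1 + m)) \in unitmx.
Proof. by rewrite unitmxE det_lblock !det1 mulr1 unitr1. Qed.

Lemma simmx_trans n (A B C P Q : 'M[F]_n) :
  P *m A = B *m P -> Q *m B = C *m Q -> (Q *m P) *m A = C *m (Q *m P).
Proof. by move=> eP eQ; rewrite -mulmxA eP mulmxA eQ mulmxA. Qed.

(** Take a vector that is not an eigenvector as first basis vector: the rest [r] of the first row is
    then nonzero, and a shear by a suitable [y] adds [r y] to the corner. *)
Lemma nonscalar_corner m (A : 'M[F]_(1 + m)) : ~~ is_scalar_mx A ->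
  exists P r c D, [/\ P \in unitmx, r != 0 &
    P *m A = block_mx (1%:M : 'M_1) r c D *m P].
Proof.
move=> /nonscalar_row[v nvA].
have v0 : v != 0 by apply: contraNneq nvA => ->; rewrite mul0mx submx_refl.
have [|P uP ePv] := @eq_rank_unitmx F 1 1 _ ('e_(0 : 'I_(1 + m))) v.
  by rewrite mxrank_delta rank_rV v0.
rewrite -rowE in ePv; have [B eB] : exists B, P *m A = B *m P.
  by exists (P *m A *m invmx P); rewrite mulmxKV.
pose r := ursubmx B.
have r0 : r != 0.
  apply: contra nvA => /eqP r0.
  rewrite (eqmxMr A ePv) ePv -row_mul eB row_mul.
  have -> : row 0 B = B 0 0 *: 'e_0.
    apply/rowP=> j; rewrite !mxE /=.
    have [->|j0] := eqVneq j 0; first by rewrite mulr1.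
    have [k ->] : exists k : 'I_m, j = rshift 1 k.
      move: j0; rewrite -(splitK j); case: (split j) => k; last by exists k.
      by case/eqP; apply: val_inj; rewrite (ord1 k).
    rewrite mulr0; have /matrixP/(_ 0 k) := r0; rewrite !mxE => <-.
    by congr (B _ _); apply: val_inj.
  by rewrite -scalemxAl -rowE scalemx_sub.
have [k rk] : exists k, r 0 k != 0 by apply/rV0Pn.
(* Chosen so that [r y = 1 - B 0 0]. *)
pose y : 'cV_m := ((1 - B 0 0) / r 0 k) *: delta_mx k 0.
have ry : ulsubmx B + r *m y = 1%:M.
  rewrite [LHS]mx11_scalar; congr _%:M.
  rewrite /y -scalemxAr -colE !mxE !lshift0.
  rewrite divfK; first by rewrite addrC subrK.
  by move: rk; rewrite /r !mxE lshift0.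
have := shear_block (ulsubmx B) r (dlsubmx B) (drsubmx B) y.
rewrite submxK ry => /(simmx_trans eB) eP.
eexists; eexists; eexists; eexists; split; last exact: eP; last exact: r0.
by rewrite unitmx_mul uP shear_unit.
Qed.

Lemma schur_factor m (r : 'rV[F]_m) (c : 'cV[F]_m) (D : 'M[F]_m) :
  block_mx (1%:M : 'M_1) r c D =
    block_mx 1%:M 0 c 1%:M *m block_mx 1%:M r 0 (D - c *m r).
Proof.
by rewrite mulmx_block !mul1mx !mulmx1 !mulmx0 !mul0mx !addr0 addrC subrK.
Qed.

Lemma simmx_det n (P A B : 'M[F]_n) :
  P \in unitmx -> P *m A = B *m P -> \det A = \det B.
Proof.
rewrite unitmxE => uP /(congr1 determinant); rewrite !det_mulmx mulrC.
exact: mulIr.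
Qed.

Lemma schur_det m (A P : 'M[F]_(1 + m)) r (c : 'cV[F]_m) D :
  P \in unitmx -> P *m A = block_mx (1%:M : 'M_1) r c D *m P ->
  \det (D - c *m r) = \det A.
Proof.
move=> uP /(simmx_det uP) ->.
by rewrite schur_factor det_mulmx det_lblock det_ublock !det1 !mul1r.
Qed.

(* If the Schur complement is a scalar a, a shear by y with r y = 0 keeps the
   corner equal to 1 and turns the Schur complement into a(1 - y r). *)
Lemma nonscalar_schur m (A : 'M[F]_(1 + m.+2)) :
    \det A = 1 -> ~~ is_scalar_mx A ->
  exists P r c D, [/\ P \in unitmx, ~~ is_scalar_mx (D - c *m r) &
    P *m A = block_mx (1%:M : 'M_1) r c D *m P].
Proof.
move=> dA /nonscalar_corner[P [r [c [D [uP r0 eP]]]]].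
have [/is_scalar_mxP[a sS]|nsS] :=
  boolP (is_scalar_mx (D - c *m r)); last first.
  by exists P, r, c, D.
have a0 : a != 0.
  have: \det (a%:M : 'M[F]_m.+2) != 0.
    by rewrite -sS (schur_det uP eP) dA oner_neq0.
  by rewrite det_scalar expf_eq0.
(* A single linear condition on a space of dimension at least 2 has a nonzero solution. *)
have [u u_ker u0] : exists2 u : 'rV_m.+2, u *m r^T = 0 & u != 0.
  have /rowV0Pn[u /sub_kermxP ur u0] : kermx r^T != 0; last by exists u.
  by rewrite -mxrank_eq0 mxrank_ker mxrank_tr rank_rV r0.
pose y := u^T.
have ry : r *m y = 0 by rewrite -[r]trmxK -trmx_mul u_ker trmx0.
have y0 : y != 0 by rewrite -trmx0 (inj_eq trmx_inj).
have Dy : D *m y = a *: y.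
  rewrite -[D](subrK (c *m r)) sS mulmxDl -mulmxA ry mulmx0 addr0.
  exact: mul_scalar_mx.
have := shear_block 1%:M r c D y; rewrite ry addr0 mulmx1.
move=> /(simmx_trans eP) eP'.
eexists; eexists; eexists; eexists; split; last exact: eP'.
  by rewrite unitmx_mul uP shear_unit.
have -> : D - y *m r - (c + D *m y - y) *m r = a%:M - a *: (y *m r).
  rewrite -sS Dy mulmxBl mulmxDl -scalemxAl.
  by rewrite opprB addrA subrK opprD addrA.
apply/negP=> /is_scalar_mxP[b eb].
(* Evaluating at [y] gives [a y = b y], so [a = b] and [y r = 0], contrary to [y] and [r] being
   nonzero. *)
have := congr1 (mulmx^~ y) eb.
rewrite mulmxBl -scalemxAl -mulmxA ry mulmx0 scaler0 subr0 !mul_scalar_mx.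
move/eqP; rewrite -subr_eq0 -scalerBl scaler_eq0 (negPf y0) orbF subr_eq0.
move/eqP=> ab; move: eb; rewrite ab => /eqP.
rewrite addrC -subr_eq0 addrK oppr_eq0 scaler_eq0 -ab (negPf a0) /=.
move=> /eqP/matrixP yr0.
have /rV0Pn[i ui] := u0; have /rV0Pn[j rj] := r0.
have := yr0 i j; rewrite !mxE big_ord1 !mxE => /eqP.
by rewrite mulf_eq0 (negPf ui) (negPf rj).
Qed.

Lemma unitrig_block m (c : 'cV[F]_m) (L : 'M[F]_m) :
  unitrig L -> unitrig (block_mx (1%:M : 'M_1) 0 c L).
Proof.
move=> tL i j; rewrite -(splitK i) -(splitK j).
case: (split i) (split j) => [i'|i'] [j'|j'] /=.
- by rewrite block_mxEul !ord1 mxE !eqxx.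
- by rewrite block_mxEur mxE -val_eqE /= (ord1 i').
- by rewrite (ord1 j').
- by rewrite block_mxEdr leq_add2l => /tL->; rewrite -!val_eqE /= eqn_add2l.
Qed.

(** The disjunction lets the induction end: a 1 by 1 Schur complement is always scalar, but
    determinant 1 makes it the identity. *)
Lemma nonscalar_sim_LU n (A : 'M[F]_n.+1) :
    \det A = 1 -> (n = 0%N) \/ ~~ is_scalar_mx A ->
  exists P L U, [/\ P \in unitmx, unitrig L, unitrig U^T &
    P *m A = L *m U *m P].
Proof.
elim: n A => [|m IHm] A dA nsA.
  exists 1%:M, 1%:M, 1%:M; split; rewrite ?unitmx1 ?trmx1 //.
  - by move=> i j _; rewrite mxE.
  - by move=> i j _; rewrite mxE.
  by rewrite !mul1mx [LHS]mx11_scalar -det_mx11 dA.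
case: nsA => // nsA.
have [P [r [c [D [uP nsS eP]]]]] : exists P r c D, [/\ P \in unitmx,
    m = 0%N \/ ~~ is_scalar_mx (D - c *m r) &
    P *m A = block_mx (1%:M : 'M_1) r c D *m P].
  case: m A dA nsA {IHm} => [|m] A dA nsA; last first.
    have [P [r [c [D [uP nsS eP]]]]] := nonscalar_schur dA nsA.
    by exists P, r, c, D; split; auto.
  have [P [r [c [D [uP _ eP]]]]] := nonscalar_corner nsA.
  by exists P, r, c, D; split; auto.
have dS := schur_det uP eP; rewrite dA in dS.
have [Q [L [U [uQ tL tU eQ]]]] := IHm _ dS nsS.
(* Conjugation by [R] replaces [c] by [Q c], [r] by [r Q^-1], and the Schur complement by its
   conjugate [L U]. *)
pose R := block_mx (1%:M : 'M_1) 0 0 Q.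
have uR : R \in unitmx by rewrite unitmxE det_lblock det1 mul1r -unitmxE.
pose L1 := block_mx (1%:M : 'M_1) 0 (Q *m c) L.
pose U1 := block_mx (1%:M : 'M_1) (r *m invmx Q) 0 U.
have eR : R *m block_mx (1%:M : 'M_1) r c D = (L1 *m U1) *m R.
  rewrite schur_factor !mulmx_block.
  rewrite !mul1mx !mulmx1 !mulmx0 !mul0mx !addr0 !add0r.
  rewrite [c *m r + _]addrC subrK mulmxDl -eQ mulmxBr !mulmxA !mulmxKV //.
  by rewrite addrC subrK.
have tU1 : unitrig U1^T.
  by rewrite tr_block_mx trmx1 trmx0; apply: unitrig_block.
exists (R *m P), L1, U1; split.
- by rewrite unitmx_mul uR.
- exact: unitrig_block.
- exact: tU1.
exact: simmx_trans eP eR.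
Qed.

Lemma nonscalar_unip2_prod n (A : 'M[F]_n.+1) (w : F) :
    w != 0 -> w != 1 -> \det A = 1 -> ~~ is_scalar_mx A ->
  unip2_prod 8 A.
Proof.
move=> w0 w1 dA nsA.
have [P [L [U [uP tL tU eP]]]] := nonscalar_sim_LU dA (or_intror nsA).
apply: unip2_prod_conj uP eP _; apply: (@unip2_prodM _ 4 4).
  exact: unitrig_unip2_prod w0 w1 tL.
by rewrite -[U]trmxK; apply/unip2_prod_tr/(unitrig_unip2_prod w0 w1).
Qed.

(** * Dimension 2 *)

Lemma unitrig_unip2 (L : 'M[F]_2) : unitrig L -> unip2 L.
Proof.
move=> tL; apply/matrixP=> i j; rewrite !mxE big1 // => k _; rewrite !mxE.
have [le_ik|lt_ki] := leqP i k; first by rewrite tL // subrr mul0r.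
have [le_kj|lt_jk] := leqP k j; first by rewrite (tL k) // subrr mulr0.
by have := leq_trans lt_ki (ltn_ord i); rewrite ltnS leqNgt (leq_trans _ lt_jk).
Qed.

Lemma nonscalar_unip2_prod_dim2 (A : 'M[F]_2) :
  \det A = 1 -> ~~ is_scalar_mx A -> unip2_prod 2 A.
Proof.
move=> dA nsA.
have [P [L [U [uP tL tU eP]]]] := nonscalar_sim_LU dA (or_intror nsA).
apply: unip2_prod_conj uP eP _; apply: (@unip2_prodM _ 1 1).
  exact/unip2_prod_unip2/unitrig_unip2.
by rewrite -[U]trmxK; apply/unip2_prod_tr/unip2_prod_unip2/unitrig_unip2.
Qed.

(** For scalar [A], splitting off the transvection [X 1] leaves the nonscalar [X (-1) A], at the
    price of a third factor. *)
Lemma unip2_prod_SL2 (A : 'M[F]_2) : \det A = 1 -> unip2_prod 3 A.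
Proof.
move=> dA.
have [/is_scalar_mxP[a defA]|nsA] := boolP (is_scalar_mx A); last first.
  rewrite -[A]mul1mx; apply: (@unip2_prodM _ 1 2); first exact: unip2_prod1.
  exact: nonscalar_unip2_prod_dim2.
have a0 : a != 0.
  by have := oner_neq0 F; rewrite -dA defA det_scalar expf_eq0.
pose X b : 'M[F]_2 := 1%:M + b *: delta_mx 1 0.
have tX b : unitrig (X b).
  move=> i j le_ij; rewrite !mxE; case: andP => [[/eqP i1 /eqP j0]|].
    by move: le_ij; rewrite i1 j0.
  by rewrite mulr0 addr0.
have XK : X 1 *m X (-1) = 1%:M.
  rewrite /X mulmxDl mul1mx mulmxDr mulmx1 scale1r scaleN1r mulmxN.
  by rewrite mul_delta_mx_0 // oppr0 addr0 subrK.
have dX b : \det (X b) = 1.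
  rewrite det_trig; last first.
    apply/is_trig_mxP=> i j lt_ij.
    by rewrite tX ?(ltnW lt_ij) // -val_eqE ltn_eqF.
  by rewrite big1 // => i _; rewrite tX // eqxx.
rewrite -[A]mul1mx -XK -mulmxA; apply: (@unip2_prodM _ 1 2).
  exact/unip2_prod_unip2/unitrig_unip2.
apply: nonscalar_unip2_prod_dim2; first by rewrite det_mulmx dX dA mulr1.
apply/is_scalar_mxP=> -[b /matrixP/(_ 1 0)].
rewrite defA mulmxDl mul1mx mul_mx_scalar !mxE /= !mulr0n add0r !mulr1 mulrN1.
by move/eqP; rewrite oppr_eq0 (negPf a0).
Qed.

(** * Diagonal and scalar matrices *)

(** The 2 by 2 diagonal blocks lie in [SL_2] and are factored in parallel, so three factors serve
    for every [n]. Indexing [d] by [nat] lets the induction shift it by two. *)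
Lemma diag_unip2_prod n (d : nat -> F) :
    (forall k, d k.*2 * d k.*2.+1 = 1) -> (odd n -> d n.-1 = 1) ->
  unip2_prod 3 (diag_mx (\row_(i < n) d i)).
Proof.
have [m] := ubnP n; elim: m n d => // m IHm [|[|n]] d le_nm d1 dn.
- have -> : diag_mx (\row_(i < 0) d i) = 1%:M; last exact: unip2_prod1.
  by apply/matrixP=> -[].
- have -> : diag_mx (\row_(i < 1) d i) = 1%:M; last exact: unip2_prod1.
  by apply/matrixP=> i j; rewrite !ord1 !mxE dn.
have -> : diag_mx (\row_(i < n.+2) d i) =
    block_mx (diag_mx (\row_(i < 2) d i)) 0 0 (diag_mx (\row_(i < n) d i.+2))
    :> 'M_(2 + n).
  rewrite -diag_mx_row; congr diag_mx.
  by apply/rowP=> i; rewrite !mxE; case: split_ordP => j ->; rewrite mxE.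
apply: (@unip2_prod_block 2 n).
  apply: unip2_prod_SL2; rewrite det_diag !big_ord_recl big_ord0 !mxE mulr1.
  exact: d1 0%N.
apply: (IHm n (fun i => d i.+2)) => [||on]; first exact: ltnW.
  by move=> k; apply: d1 k.+1.
by case: n on dn {le_nm} => //= n on; apply; rewrite negbK.
Qed.

(* a I_n = D1 D2 with D1 = diag(a, a^-1, a^3, a^-3, ..) and
   D2 = diag(1, a^2, a^-2, a^4, a^-4, ..); a^n = 1 makes the unpaired last
   entry, in whichever of D1 and D2 it occurs, equal to 1. *)
Lemma scalar_unip2_prod n (a : F) :
  a ^+ n.+1 = 1 -> unip2_prod 6 (a%:M : 'M_n.+1).
Proof.
move=> an1; have a0 : a != 0.
  by have := oner_neq0 F; rewrite -an1 expf_eq0.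
pose d1 i := if odd i then a ^- i else a ^+ i.+1.
pose d2 i := if odd i then a ^- i.+1 else a ^+ i.+2.
pose D2 := block_mx (1%:M : 'M_1) 0 0 (diag_mx (\row_(i < n) d2 i)).
have -> : a%:M = diag_mx (\row_(i < n.+1) d1 i) *m D2.
  have -> : D2 = diag_mx (row_mx (const_mx 1) (\row_(i < n) d2 i)).
    by rewrite diag_mx_row diag_const_mx.
  rewrite mulmx_diag -diag_const_mx; congr diag_mx.
  apply/rowP=> i; rewrite !mxE.
  case: (@split_ordP 1 n i) => j ->; rewrite !mxE.
    by rewrite (ord1 j) /d1 /= mulr1.
  have -> : rshift 1 j = j.+1 :> nat by [].
  (* At position [j + 1] the exponents of [d1] and [d2] are [j + 2] and [-(j + 1)] in one order or
     the other, with sum 1. *)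
  rewrite /d1 /d2 /=; case: odd; rewrite /=; last rewrite [RHS]mulrC.
    by rewrite [a ^+ j.+2]exprS mulfK ?expf_neq0.
  by rewrite [a ^+ j.+2]exprS mulfK ?expf_neq0.
apply: (@unip2_prodM _ 3 3).
  apply: diag_unip2_prod => [k|on]; rewrite /d1 /=.
    by rewrite odd_double /= mulfV // expf_neq0.
  by move: on => /=; case: odd.
apply: (@unip2_prod_block 1 n); first exact: unip2_prod1.
apply: diag_unip2_prod => [k|on]; rewrite /d2 /=.
  by rewrite odd_double /= mulfV // expf_neq0.
by case: n on an1 {D2} => //= n; case: (odd n).
Qed.

End SquareZeroProducts.

Theorem corollary4p9 (F : fieldType)
    (hF : exists s : seq F, uniq s /\ (4 <= size s)%N) :
  (forall A : 'M[F]_2, \det A = 1 -> prod_at_most_U2 6 A) /\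
  (forall (n : nat) (A : 'M[F]_n),
     (2 < n)%N -> \det A = 1 -> prod_at_most_U2 8 A).
Proof.
have [w w0 w1] : exists2 w : F, w != 0 & w != 1.
  have [s [s_uniq sz_s]] := hF.
  have /hasP[w _] : has [predC [:: 0; 1]] s; last first.
    by rewrite !inE negb_or => /andP[w0 w1]; exists w.
  (* A duplicate-free list inside [[:: 0; 1]] has at most two entries. *)
  rewrite has_predC; apply: contraL sz_s => /allP/(uniq_leq_size s_uniq) sz_s.
  by rewrite -ltnNge ltnS (leq_trans sz_s).
split=> [A dA|[//|n] A _ dA]; apply: unip2_prod_at_most_U2.
  (* Trivial factors pad the three up to six. *)
  rewrite -[A]mul1mx; apply: (@unip2_prodM _ _ 3 3); first exact: unip2_prod1.
  exact: unip2_prod_SL2.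
have [/is_scalar_mxP[a defA]|nsA] := boolP (is_scalar_mx A).
  rewrite -[A]mul1mx; apply: (@unip2_prodM _ _ 2 6); first exact: unip2_prod1.
  by rewrite defA; apply: scalar_unip2_prod; rewrite -det_scalar -defA.
exact: nonscalar_unip2_prod w0 w1 dA nsA.
Qed.
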